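(* Let $n\ge1$ be an integer, $Q=2n+2$, and $1<q<\infty$. If $p(\cdot):\mathbb{H}^n\to(0,\infty)$ is an exponent function on $\mathbb{H}^n$ with $0<p_-\le p_+<\infty$ such that $p_{+} \leq Q\, (2 + Q/q)^{-1}$, then the variable Calderón-Hardy space satisfies $\mathcal{H}^{p(\cdot)}_{q, 2}(\mathbb{H}^{n}) = \{ 0 \}$.
   Context: **Heisenberg group.** $\mathbb{H}^n$ is $\mathbb{R}^{2n}\times\mathbb{R}$ with group law $(x,t)\cdot(y,s)=(x+y,\,t+s+x^{t}Jy)$, where $J=2\begin{pmatrix}0&-I_n\\ I_n&0\end{pmatrix}$ and $I_n$ is the $n\times n$ identity matrix; $(x,t)^{-1}=(-x,-t)$. The Koranyi norm is $\rho(x,t)=(|x|^4+t^2)^{1/4}$, with $|\cdot|$ the Euclidean norm on $\mathbb{R}^{2n}$. The $\rho$-balls are $B(z_0,\delta)=\{w\in\mathbb{H}^n:\rho(z_0^{-1}\cdot w)<\delta\}$. Haar measure is Lebesgue measure on $\mathbb{R}^{2n+1}$, and $|E|$ denotes the measure of $E$. $Q=2n+2$ is the homogeneous dimension. **Polynomials.** For a multi-index $I=(i_1,\dots,i_{2n+1})\in\mathbb{N}_0^{2n+1}$ put $d(I)=i_1+\cdots+i_{2n}+2i_{2n+1}$ and $z^I=x_1^{i_1}\cdots x_{2n}^{i_{2n}}t^{i_{2n+1}}$ for $z=(x,t)$. $\mathcal{P}_1$ is the space of polynomials $\sum_{d(I)\le 1}c_Iz^I$, $c_I\in\mathbb{C}$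 (homogeneous degree at most $1$). **Exponents and variable Lebesgue spaces.** An exponent is a measurable function $p(\cdot):\mathbb{H}^n\to(0,\infty)$; $p_-=\operatorname{ess\,inf}_{\mathbb{H}^n}p$ and $p_+=\operatorname{ess\,sup}_{\mathbb{H}^n}p$. Put $\kappa_{p(\cdot)}(f)=\int_{\mathbb{H}^n}|f(z)|^{p(z)}dz$. $L^{p(\cdot)}(\mathbb{H}^n)$ is the set of measurable $f$ on $\mathbb{H}^n$ with $\kappa_{p(\cdot)}(f/\lambda)<\infty$ for some $\lambda>0$. **Variable Calderón-Hardy space ($\gamma=2$, $k=1$).** For $g\in L^q_{loc}(\mathbb{H}^n)$ and a $\rho$-ball $B$ put $|g|_{q,B}=\left(|B|^{-1}\int_B|g(w)|^q\,dw\right)^{1/q}$ and $\eta_{q,2}(g;z)=\sup_{r>0}r^{-2}|g|_{q,B(z,r)}$. Let $E^q_1=L^q_{loc}(\mathbb{H}^n)/\mathcal{P}_1$; elements $G\in E^q_1$ are regarded as classes of functions. For $G\in E^q_1$ put $N_{q,2}(G;z)=\inf\{\eta_{q,2}(g;z):g\in G\}$. Then $\mathcal{H}^{p(\cdot)}_{q,2}(\mathbb{H}^n)$ is the set of $G\in E^q_1$ with $N_{q,2}(G;\cdot)\in L^{p(\cdot)}(\mathbb{H}^n)$. *)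

(* Defs.v *)
From HB Require Import structures.
From mathcomp Require Import all_boot all_order all_algebra.
From mathcomp Require Import all_classical all_reals all_analysis.
From mathcomp Require Import measurable_realfun ess_sup_inf complex.

Set Implicit Arguments.
Unset Strict Implicit.
Unset Printing Implicit Defensive.

Import Order.TTheory GRing.Theory Num.Theory.
Import numFieldNormedType.Exports.

Local Open Scope classical_set_scope.
Local Open Scope ring_scope.
Local Open Scope complex_scope.

(* R^m is 'rV[R]_m.  Its Borel sigma-algebra is generated by the coordinate
   projections, as the library does for n.-tuple T. *)

Section measurable_rV.
Context {d} {T : measurableType d} (m : nat).

Let coor (i : 'I_m) (v : 'rV[T]_m) : T := v ord0 i.

Let rV_set0 : g_sigma_preimage coor set0.
Proof. exact: sigma_algebra0. Qed.

Let rV_setC A : g_sigma_preimage coor A -> g_sigma_preimage coor (~` A).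
Proof. exact: sigma_algebraC. Qed.

Let rV_bigcup (F : (set 'rV[T]_m)^nat) :
  (forall i, g_sigma_preimage coor (F i)) ->
  g_sigma_preimage coor (\bigcup_i F i).
Proof. exact: sigma_algebra_bigcup. Qed.

HB.instance Definition _ := @isMeasurable.Build (measure_tuple_display d)
  'rV[T]_m (g_sigma_preimage coor) rV_set0 rV_setC rV_bigcup.

Lemma measurable_rV_coor (i : 'I_m) :
  measurable_fun [set: 'rV[T]_m] (fun v => v ord0 i).
Proof.
move=> _ Y mY; rewrite setTI; apply: sub_sigma_algebra => /=.
rewrite -bigcup_seq/=; exists i => /=; first by rewrite mem_index_enum.
by exists Y => //; rewrite setTI.
Qed.

Lemma measurable_fun_rV d' (T' : measurableType d') (f : T' -> 'rV[T]_m) :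
  (forall i, measurable_fun [set: T'] (fun x => f x ord0 i)) ->
  measurable_fun [set: T'] f.
Proof.
move=> mf _ Y; rewrite setTI => mY.
suff : @measurable _ 'rV[T]_m `<=` [set A | measurable (f @^-1` A)] by exact.
apply: smallest_sub => [|A]; first split => /=.
- by rewrite preimage_set0.
- by move=> A mA; rewrite setTD preimage_setC; exact: measurableC.
- by move=> F mF; rewrite preimage_bigcup; exact: bigcup_measurable.
rewrite -bigcup_seq => -[i _ [B mB <-]]; rewrite setTI /=.
by have := mf i measurableT B mB; rewrite setTI.
Qed.

End measurable_rV.

(* lebesgue_measure is declared on measurableTypeR R; the same set function is
   used here on R equipped with its own (identical) Borel sigma-algebra. *)

Section lebesgueR.
Context {R : realType}.

Definition lebesgueR : set R -> \bar R := @lebesgue_measure R.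

Let lebesgueR0 : lebesgueR set0 = 0%E.
Proof. exact: measure0. Qed.

Let lebesgueR_ge0 A : (0 <= lebesgueR A)%E.
Proof. exact: measure_ge0. Qed.

Let lebesgueR_sigma_additive : semi_sigma_additive lebesgueR.
Proof. exact: (@measure_semi_sigma_additive _ _ _ (@lebesgue_measure R)). Qed.

HB.instance Definition _ := isMeasure.Build _ _ _ lebesgueR
  lebesgueR0 lebesgueR_ge0 lebesgueR_sigma_additive.

Let lebesgueR_sigma_finite : sigma_finite setT lebesgueR.
Proof. exact: (sigma_finiteT (@lebesgue_measure R)). Qed.

HB.instance Definition _ := @Measure_isSigmaFinite.Build _ _ _ lebesgueR
  lebesgueR_sigma_finite.

End lebesgueR.

(* Lebesgue measure on the Borel subsets of R^m, by recursion on m: the image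
   of (lebesgueR \x lebesgue_rV m) under the identification
   R * R^m -> R^(1 + m). *)

Section lebesgue_rV.
Context {R : realType}.

Definition rV_cons m (z : R * 'rV[R]_m) : 'rV[R]_m.+1 :=
  \row_i oapp (z.2 ord0) z.1 (unlift ord0 i).

Definition rV_uncons m (v : 'rV[R]_m.+1) : R * 'rV[R]_m :=
  (v ord0 ord0, \row_i v ord0 (lift ord0 i)).

Lemma rV_consK m : cancel (@rV_cons m) (@rV_uncons m).
Proof.
move=> [a v]; rewrite /rV_uncons mxE unlift_none /=; congr pair.
by apply/rowP => i; rewrite !mxE liftK.
Qed.

Lemma measurable_rV_cons m : measurable_fun setT (@rV_cons m).
Proof.
apply: measurable_fun_rV => i; under eq_fun do rewrite mxE.
case: (unlift ord0 i) => [j|] /=; last exact: measurable_fst.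
apply: (@measurableT_comp _ _ _ _ _ _ (fun v : 'rV[R]_m => v ord0 j)).
  exact: measurable_rV_coor.
exact: measurable_snd.
Qed.

Lemma measurable_rV_uncons m : measurable_fun setT (@rV_uncons m).
Proof.
apply: measurable_fun_pair => /=; first exact: measurable_rV_coor.
apply: measurable_fun_rV => i; under eq_fun do rewrite mxE.
exact: measurable_rV_coor.
Qed.

Section step.
Variables (m : nat) (mu : {sigma_finite_measure set 'rV[R]_m -> \bar R}).

Definition lebesgue_rVS : set 'rV[R]_m.+1 -> \bar R :=
  pushforward (@lebesgueR R \x mu)%E (@rV_cons m).

Let lebesgue_rVS0 : lebesgue_rVS set0 = 0%E.
Proof. by rewrite /lebesgue_rVS /pushforward preimage_set0 measure0. Qed.

Let lebesgue_rVS_ge0 A : (0 <= lebesgue_rVS A)%E.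
Proof. by rewrite /lebesgue_rVS /pushforward measure_ge0. Qed.

Let lebesgue_rVS_sigma_additive : semi_sigma_additive lebesgue_rVS.
Proof.
move=> F mF tF mUF; rewrite /lebesgue_rVS /pushforward preimage_bigcup.
have mcons A : measurable A -> measurable (@rV_cons m @^-1` A).
  by move=> mA; rewrite -[X in measurable X]setTI; exact: measurable_rV_cons.
apply: measure_semi_sigma_additive => [n||]; first exact: mcons.
- apply/trivIsetP => /= i j _ _ ij; rewrite -preimage_setI.
  by move/trivIsetP : tF => /(_ _ _ _ _ ij) ->//; rewrite preimage_set0.
- by rewrite -preimage_bigcup; exact: mcons.
Qed.

HB.instance Definition _ := isMeasure.Build _ _ _ lebesgue_rVS
  lebesgue_rVS0 lebesgue_rVS_ge0 lebesgue_rVS_sigma_additive.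

Let lebesgue_rVS_sigma_finite : sigma_finite setT lebesgue_rVS.
Proof.
have /sigma_finiteP[F [FT ndF Foo]] := sigma_finiteT (@lebesgueR R).
have /sigma_finiteP[G [GT ndG Goo]] := sigma_finiteT mu.
have mFG k : measurable (F k `*` G k).
  by apply: measurableX; [exact: (Foo k).1|exact: (Goo k).1].
exists (fun k => @rV_uncons m @^-1` (F k `*` G k)).
  rewrite -preimage_bigcup; apply/esym; rewrite -subTset => v _ /=.
  have [i _ Fi] : (\bigcup_k F k) (rV_uncons v).1 by rewrite -FT; exact: I.
  have [j _ Gj] : (\bigcup_k G k) (rV_uncons v).2 by rewrite -GT; exact: I.
  exists (maxn i j) => //; split.
    by move: Fi; apply: (subsetPset _ _ (ndF _ _ (leq_maxl i j))).
  by move: Gj; apply: (subsetPset _ _ (ndG _ _ (leq_maxr i j))).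
move=> k; split.
  by have := @measurable_rV_uncons m measurableT _ (mFG k); rewrite setTI.
rewrite /lebesgue_rVS /pushforward -comp_preimage.
rewrite (_ : _ \o _ = id) ?preimage_id; last first.
  by apply/funext => z /=; rewrite rV_consK.
rewrite product_measure1E; [|exact: (Foo k).1|exact: (Goo k).1].
apply: lte_mul_pinfty => //; last exact: (Goo k).2.
by rewrite ge0_fin_numE//; exact: (Foo k).2.
Qed.

HB.instance Definition _ := @Measure_isSigmaFinite.Build _ _ _ lebesgue_rVS
  lebesgue_rVS_sigma_finite.

End step.

Fixpoint lebesgue_rV m : {sigma_finite_measure set 'rV[R]_m -> \bar R} :=
  match m with
  | 0 => \d_(0 : 'rV[R]_0)
  | m'.+1 => lebesgue_rVS (lebesgue_rV m')
  end.

End lebesgue_rV.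

(* The Heisenberg group, with points z = (x, t) where x is a row vector. *)

Definition heis (R : realType) (n : nat) : Type := ('rV[R]_(n + n) * R)%type.

Definition lebesgue_borel_heis (R : realType) (n : nat) :
    set ('rV[R]_(n + n) * R) -> \bar R :=
  (lebesgue_rV (n + n) \x @lebesgueR R)%E.

HB.instance Definition _ (R : realType) (n : nat) :=
  Measure.on (@lebesgue_borel_heis R n).

(* heis R n carries the Euclidean topology, and the sigma-algebra of
   Lebesgue-measurable (not just Borel) sets, obtained by completion. *)
HB.instance Definition _ (R : realType) (n : nat) :=
  Topological.copy (heis R n) ('rV[R]_(n + n) * R)%type.
HB.instance Definition _ (R : realType) (n : nat) :=
  Measurable.copy (heis R n)
    (caratheodory_type (mu_ext (@lebesgue_borel_heis R n))).

Definition lebesgue_heis {R : realType} {n : nat} : set (heis R n) -> \bar R :=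
  @completed_measure_extension _ _ _ (@lebesgue_borel_heis R n).

HB.instance Definition _ (R : realType) (n : nat) :=
  Measure.on (@lebesgue_heis R n).

Section heisenberg.
Context {R : realType} {n : nat}.
Local Notation H := (heis R n).
Local Notation C := R[i].
Local Notation mu := (@lebesgue_heis R n).

Definition heisJ : 'M[R]_(n + n) :=
  2%:R *: block_mx 0 (- 1%:M) 1%:M 0.

Definition heis_mul (z w : H) : H :=
  (z.1 + w.1, z.2 + w.2 + (z.1 *m heisJ *m w.1^T) ord0 ord0).

Definition heis_inv (z : H) : H := (- z.1, - z.2).

Definition enorm (x : 'rV[R]_(n + n)) : R :=
  Num.sqrt (\sum_i x ord0 i ^+ 2).

Definition koranyi (z : H) : R := (enorm z.1 ^+ 4 + z.2 ^+ 2) `^ (4%:R^-1).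

Definition kball (z0 : H) (delta : R) : set H :=
  [set w | koranyi (heis_mul (heis_inv z0) w) < delta].

(* A multi-index I = (i_1, ..., i_2n, i_(2n+1)) is stored as the pair
   ((i_1, ..., i_2n), i_(2n+1)). *)
Definition multiindex : Type := ({ffun 'I_(n + n) -> nat} * nat)%type.

Definition hdeg (I : multiindex) : nat := (\sum_i I.1 i + 2 * I.2)%N.

Definition monomial (I : multiindex) (z : H) : R :=
  (\prod_i z.1 ord0 i ^+ I.1 i) * z.2 ^+ I.2.

Definition heis_poly (k : nat) : set (H -> C) :=
  [set P | exists (s : seq multiindex) (c : multiindex -> C),
    (forall I, I \in s -> (hdeg I <= k)%N) /\
    forall z, P z = \sum_(I <- s) c I * (monomial I z)%:C].

Definition is_exponent (p : H -> R) : Prop :=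
  measurable_fun setT p /\ forall z, 0 < p z.

Definition p_minus (p : H -> R) : \bar R := ess_inf mu (EFin \o p).
Definition p_plus (p : H -> R) : \bar R := ess_sup mu (EFin \o p).

(* Functions with values in the extended reals are allowed, since the maximal
   functions below may take the value +oo. *)
Definition modular (p : H -> R) (f : H -> \bar R) : \bar R :=
  (\int[mu]_z (`|f z| `^ p z))%E.

Definition Lvar (p : H -> R) : set (H -> \bar R) :=
  [set f : H -> \bar R | measurable_fun setT f /\
    exists2 lambda : R, 0 < lambda &
      (modular p (fun z => (lambda^-1)%:E * f z) < +oo)%E].

Definition measurable_complex (g : H -> C) : Prop :=
  measurable_fun setT (fun z => complex.Re (g z)) /\
  measurable_fun setT (fun z => complex.Im (g z)).

Definition Lqloc (q : R) : set (H -> C) :=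
  [set g : H -> C | measurable_complex g /\
    forall K : set H, compact K ->
      (\int[mu]_(w in K) (Normc.normc (g w) `^ q)%:E < +oo)%E].

Definition avgq (q : R) (g : H -> C) (B : set H) : \bar R :=
  (((mu B)^-1 * \int[mu]_(w in B) (Normc.normc (g w) `^ q)%:E)
     `^ (q^-1)%R)%E.

Definition eta2 (q : R) (g : H -> C) (z : H) : \bar R :=
  ereal_sup [set ((r ^- 2)%:E * avgq q g (kball z r))%E | r in [set r | 0 < r]].

(* The class of g in Lqloc / P_1; as usual, elements of Lqloc are themselves
   identified when they agree almost everywhere. *)
Definition classE1 (q : R) (g : H -> C) : set (H -> C) :=
  [set h | Lqloc q h /\
    exists2 P, heis_poly 1 P & {ae mu, forall w, h w = g w + P w}].

Definition E1 (q : R) : set (set (H -> C)) := classE1 q @` Lqloc q.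

Definition zeroE1 (q : R) : set (H -> C) := classE1 q (fun=> 0).

Definition N2 (q : R) (G : set (H -> C)) (z : H) : \bar R :=
  ereal_inf [set eta2 q g z | g in G].

Definition calderon_hardy (p : H -> R) (q : R) : set (set (H -> C)) :=
  [set G | E1 q G /\ Lvar p (N2 q G)].

End heisenberg.

Definition hom_dim (n : nat) : nat := (2 * n + 2)%N.

(* Main.v *)
Require Import Defs.
From mathcomp Require Import all_boot all_order all_algebra.
From mathcomp Require Import all_classical all_reals all_analysis.
From mathcomp Require Import measurable_realfun ess_sup_inf complex ring lra.

(** A class G other than that of 0 stays away from zero on some fixed box: there
    are a bounded set and eps, beta > 0 such that every g in G satisfies
    |g| >= eps on a subset of it of measure at least beta. Indeed g runs over
    g0 + P with P affine in x, and if affine functions approximated the real (or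
    imaginary) part of g0 arbitrarily well in measure on every box, their
    coefficients would converge and that part would be affine a.e.
    For z in a large gauge box of size s, the Koranyi ball of radius C s about z
    contains that bounded set, so N_{q,2}(G; z) >= c s^-(2 + Q/q). As
    p <= Q / (2 + Q/q) a.e., each dyadic annulus contributes at least a fixed
    positive amount to the modular, which is therefore infinite. *)

Set Implicit Arguments.
Unset Strict Implicit.
Unset Printing Implicit Defensive.

Import Order.TTheory GRing.Theory Num.Theory.
Import numFieldNormedType.Exports.

Local Open Scope classical_set_scope.
Local Open Scope ring_scope.

(** * Lebesgue measure of boxes in R^m and in the Heisenberg group *)

Section measure_of_boxes.
Context {R : realType}.

Definition cube m (a : 'rV[R]_m) (s : R) : set 'rV[R]_m :=
  [set v | forall i, `|v ord0 i - a ord0 i| <= s].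

Lemma dist_itv (a s : R) : [set x | `|x - a| <= s] = `[a - s, a + s]%classic.
Proof. by apply/seteqP; split => x /=; rewrite in_itv/= ler_distl. Qed.

Lemma lebesgueR_itv (a s : R) : 0 <= s ->
  lebesgueR [set x | `|x - a| <= s] = (2 * s)%:E.
Proof.
move=> s0; rewrite dist_itv /lebesgueR lebesgue_measure_itv/= lte_fin.
case: ltP => h; first by rewrite -EFinD; congr EFin; ring.
by congr EFin; lra.
Qed.

Lemma measurable_dist_itv (a s : R) : measurable [set x : R | `|x - a| <= s].
Proof. by rewrite dist_itv; exact: measurable_itv. Qed.

Lemma measurable_cube m (a : 'rV[R]_m) s : measurable (cube a s).
Proof.
rewrite (_ : cube a s = \bigcap_(i in [set: 'I_m])
    ((fun v : 'rV[R]_m => v ord0 i) @^-1` [set x | `|x - a ord0 i| <= s])).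
  apply: fin_bigcap_measurable => // i _.
  rewrite -[X in measurable X]setTI.
  exact: (measurable_rV_coor i measurableT (measurable_dist_itv _ _)).
by apply/seteqP; split => v /= h i; [move=> _|]; exact: h.
Qed.

(** By induction on the dimension: pulled back along [rV_cons], a cube is an interval times a cube
    of one dimension less. In dimension 0 the cube is the whole one-point space, of Dirac mass 1. *)
Lemma lebesgue_cube m (a : 'rV[R]_m) s : 0 <= s ->
  lebesgue_rV m (cube a s) = ((2 * s) ^+ m)%:E.
Proof.
move=> s0; elim: m a => [|m IHm] a.
  by rewrite /= diracE mem_set// => -[].
rewrite exprS EFinM -(IHm (\row_i a ord0 (lift ord0 i))).
rewrite -(lebesgueR_itv (a ord0 ord0) s0).
rewrite -product_measure1E; [|exact: measurable_dist_itv|exact: measurable_cube].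
rewrite /= /lebesgue_rVS /pushforward; congr (_ _).
apply/seteqP; split => -[x v] /=.
  move=> h; split => /=; first by have := h ord0; rewrite mxE unlift_none.
  by move=> i; have := h (lift ord0 i); rewrite !mxE liftK.
move=> [/= h0 h] i; rewrite mxE; case: unliftP => [j|] ->//=.
by have := h j; rewrite mxE.
Qed.

Context {n : nat}.
Local Notation H := (heis R n).
Local Notation mu := (@lebesgue_heis R n).

Definition hbox (a : 'rV[R]_(n + n)) (s b h : R) : set H :=
  [set z : H | cube a s z.1 /\ `|z.2 - b| <= h].

Lemma measurable_heis_borel (A : set ('rV[R]_(n + n) * R)) :
  measurable A -> measurable (A : set H).
Proof. by move=> mA; apply: sub_caratheodory; exact: sub_sigma_algebra. Qed.

Lemma lebesgue_heis_borel (A : set ('rV[R]_(n + n) * R)) :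
  measurable A -> mu A = lebesgue_borel_heis A.
Proof. by move=> mA; rewrite /lebesgue_heis; exact: measurable_mu_extE. Qed.

(** As a set function, [mu] is the outer extension [mu_ext], monotone on arbitrary sets. Koranyi
    balls can thus be compared with boxes without a proof that they are measurable. *)
Lemma le_lebesgue_heis (A B : set H) : A `<=` B -> (mu A <= mu B)%E.
Proof. exact: (@le_mu_ext _ _ _ (@lebesgue_borel_heis R n)). Qed.

Lemma measurable_hbox a s b h : measurable (hbox a s b h).
Proof.
apply: measurable_heis_borel.
rewrite (_ : hbox a s b h = cube a s `*` [set t | `|t - b| <= h])//.
by apply: measurableX; [exact: measurable_cube|exact: measurable_dist_itv].
Qed.

Lemma lebesgue_hbox a s b h : 0 <= s -> 0 <= h ->
  mu (hbox a s b h) = ((2 * s) ^+ (n + n) * (2 * h))%:E.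
Proof.
move=> s0 h0; have mc := measurable_cube a s; have mi := measurable_dist_itv b h.
rewrite (_ : hbox a s b h = cube a s `*` [set t | `|t - b| <= h])//.
rewrite lebesgue_heis_borel; last exact: measurableX.
rewrite /lebesgue_borel_heis product_measure1E//.
by rewrite EFinM; congr (_ * _)%E; [exact: lebesgue_cube|exact: lebesgueR_itv].
Qed.

End measure_of_boxes.

(** * Comparison of gauge boxes with Koranyi balls *)

Section gauge.
Context {R : realType} {n : nat}.
Local Notation H := (heis R n).
Local Notation mu := (@lebesgue_heis R n).
Local Notation N := (n + n)%N.

(* The balls of the gauge max(|x_i|, |t|^(1/2)), equivalent to the Koranyi norm. *)
Definition gbox (s : R) : set H := hbox 0 s 0 (s ^+ 2).

Lemma gboxE (s : R) (z : H) :
  gbox s z <-> (forall i, `|z.1 ord0 i| <= s) /\ `|z.2| <= s ^+ 2.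
Proof.
rewrite /gbox /hbox /cube /=; split => -[h ht]; split.
- by move=> i; have := h i; rewrite mxE subr0.
- by move: ht; rewrite subr0.
- by move=> i; rewrite mxE subr0.
- by rewrite subr0.
Qed.

Lemma subset_gbox (s r : R) : 0 <= s -> s <= r -> gbox s `<=` gbox r.
Proof.
move=> s0 sr z /gboxE[h ht]; apply/gboxE; split => [i|].
  exact: le_trans (h i) sr.
by apply: le_trans ht _; rewrite lerXn2r ?nnegrE// (le_trans s0).
Qed.

Lemma measurable_gbox s : measurable (gbox s).
Proof. exact: measurable_hbox. Qed.

(** The N sides of length 2s and the height 2s^2 produce the exponent N + 2 = Q. *)
Lemma lebesgue_gbox s : 0 <= s ->
  mu (gbox s) = (2 ^+ N.+1 * s ^+ hom_dim n)%:E.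
Proof.
move=> s0; rewrite lebesgue_hbox ?sqr_ge0//; congr EFin.
by rewrite exprMn /hom_dim mul2n -addnn (exprD s N) (exprS 2); ring.
Qed.

Lemma normr_heisJ (i j : 'I_N) : `|heisJ i j : R| <= 2.
Proof.
rewrite /heisJ mxE -[leRHS]mulr1 normrM ger0_norm// ler_pM2l//.
rewrite -(splitK i) -(splitK j).
case: (fintype.split i) => k; case: (fintype.split j) => l /=.
- by rewrite block_mxEul mxE normr0.
- by rewrite block_mxEur !mxE normrN; case: (_ == _); rewrite ?normr1 ?normr0.
- by rewrite block_mxEdl !mxE; case: (_ == _); rewrite ?normr1 ?normr0.
- by rewrite block_mxEdr mxE normr0.
Qed.

(** The double sum has N^2 terms, each at most [a * 2 * b] because the entries of [heisJ] are
    bounded by 2. *)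
Lemma normr_heis_form (x y : 'rV[R]_N) (a b : R) : 0 <= a -> 0 <= b ->
  (forall i, `|x ord0 i| <= a) -> (forall i, `|y ord0 i| <= b) ->
  `|(x *m heisJ *m y^T) ord0 ord0| <= 2 * N%:R ^+ 2 * (a * b).
Proof.
move=> a0 b0 ha hb; rewrite mxE.
apply: le_trans (ler_norm_sum _ _ _) _.
apply: (@le_trans _ _ (\sum_(j < N) 2 * N%:R * (a * b))); last first.
  by rewrite sumr_const card_ord -mulr_natl le_eqVlt; apply/orP; left; apply/eqP; ring.
apply: ler_sum => j _; rewrite !mxE normrM.
have -> : 2 * N%:R * (a * b) = (N%:R * (a * 2)) * b :> R by ring.
apply: ler_pM => //.
apply: le_trans (ler_norm_sum _ _ _) _.
rewrite -[in leRHS](card_ord N) mulr_natl -sumr_const.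
apply: ler_sum => i _; rewrite normrM; apply: ler_pM => //.
exact: normr_heisJ.
Qed.

Lemma enorm_ge0 (x : 'rV[R]_N) : 0 <= enorm x.
Proof. exact: sqrtr_ge0. Qed.

Lemma enorm_sqr (x : 'rV[R]_N) : enorm x ^+ 2 = \sum_i x ord0 i ^+ 2.
Proof. by rewrite sqr_sqrtr// sumr_ge0// => i _; exact: sqr_ge0. Qed.

Lemma koranyi_lt (z : H) (r : R) : 0 < r ->
  (koranyi z < r) = (enorm z.1 ^+ 4 + z.2 ^+ 2 < r ^+ 4).
Proof.
move=> r0; set y := _ + _.
have y0 : 0 <= y by rewrite addr_ge0 ?sqr_ge0// exprn_ge0// enorm_ge0.
have e4 : koranyi z ^+ 4 = y.
  by rewrite -powR_mulrn ?powR_ge0// /koranyi -powRrM mulVf// powRr1.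
by rewrite -e4 ltr_pXn2r// nnegrE ?powR_ge0// ltW.
Qed.

Lemma koranyi_gbox (z : H) (r : R) : 0 < r -> koranyi z < r -> gbox r z.
Proof.
move=> r0; rewrite koranyi_lt// => h.
have e0 := exprn_ge0 4 (enorm_ge0 z.1).
apply/gboxE; split => [i|].
  have le2 : z.1 ord0 i ^+ 2 <= enorm z.1 ^+ 2.
    rewrite enorm_sqr (bigD1 i)//= lerDl sumr_ge0// => j _; exact: sqr_ge0.
  rewrite -(@ler_pXn2r _ 4)// ?nnegrE// ?(ltW r0)// (le_trans _ (ltW h))//.
  rewrite -[leLHS]addr0 lerD ?sqr_ge0//.
  by rewrite -[4%N]/(2 * 2)%N !exprM real_normK ?num_real// lerXn2r ?nnegrE ?sqr_ge0.
rewrite -(@ler_pXn2r _ 2)// ?nnegrE ?exprn_ge0 ?(ltW r0)//.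
by rewrite real_normK ?num_real// -exprM (le_trans _ (ltW h))// lerDr.
Qed.

(** On the box |x|^2 <= N s^2 and t^2 <= s^4, and N^2 + 1 < (N + 2)^4 even for N = 0. *)
Lemma gbox_koranyi (z : H) (s : R) : 0 < s -> gbox s z -> koranyi z < N.+2%:R * s.
Proof.
move=> s0 /gboxE[h ht]; rewrite koranyi_lt ?mulr_gt0//.
have e2 : enorm z.1 ^+ 2 <= N%:R * s ^+ 2.
  rewrite enorm_sqr -[in leRHS](card_ord N) mulr_natl -sumr_const.
  apply: ler_sum => i _; rewrite -[leLHS]real_normK ?num_real//.
  by rewrite lerXn2r ?nnegrE// ltW.
have e4 : enorm z.1 ^+ 4 <= (N%:R * s ^+ 2) ^+ 2.
  rewrite -[4%N]/(2 * 2)%N exprM lerXn2r ?nnegrE ?sqr_ge0//.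
  by rewrite mulr_ge0 ?sqr_ge0.
have t2 : z.2 ^+ 2 <= (s ^+ 2) ^+ 2.
  by rewrite -[leLHS]real_normK ?num_real// lerXn2r ?nnegrE// sqr_ge0.
apply: le_lt_trans (lerD e4 t2) _.
have -> : (N%:R * s ^+ 2) ^+ 2 + (s ^+ 2) ^+ 2 = (N%:R ^+ 2 + 1) * s ^+ 4 by ring.
rewrite exprMn ltr_pM2r ?exprn_gt0// -[N.+2%:R]natr1 -natr1 -addrA.
have : 0 <= N%:R :> R by []. move: (N%:R : R) => t t0.
have -> : (t + (1 + 1)) ^+ 4 = t ^+ 4 + 8 * t ^+ 3 + 24 * t ^+ 2 + 32 * t + 16 by ring.
have := exprn_ge0 4 t0; have := exprn_ge0 3 t0; have := exprn_ge0 2 t0; lra.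
Qed.

(* Both constants come from |x^t J y| <= 2 N^2 max|x_i| max|y_j|. *)
Lemma gbox_sub_kball (z : H) (s : R) : 0 < s -> gbox s z ->
  gbox s `<=` kball z (N.+2%:R * ((2 * N.+1)%:R * s)).
Proof.
move=> s0 /gboxE[hz tz] w /gboxE[hw tw]; apply: gbox_koranyi; first by rewrite mulr_gt0.
have sN : 2 * s <= (2 * N.+1)%:R * s by rewrite natrM ler_pM2r// ler_peMr// ler1n.
apply/gboxE; rewrite /heis_mul /heis_inv /=; split => [i|].
  rewrite !mxE (le_trans (ler_normD _ _))// normrN (le_trans _ sN)//.
  by have := hz i; have := hw i; lra.
have hf := @normr_heis_form (- z.1) w.1 s s (ltW s0) (ltW s0) _ hw.
have {}hf := hf (fun i => _); rewrite (le_trans (ler_normD _ _))//.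
apply: le_trans (lerD (ler_normD _ _) (hf _)) _; first by move=> i; rewrite mxE normrN.
rewrite normrN exprMn natrM -[N.+1%:R]natr1.
have : 0 <= N%:R :> R by []. move: (N%:R : R) => t t0.
have s2 := sqr_ge0 s; move: tz tw; rewrite !expr2 in s2 *.
have := mulr_ge0 t0 s2; have := mulr_ge0 (mulr_ge0 t0 t0) s2; lra.
Qed.

Lemma kball_sub_gbox (z : H) (s r : R) : 0 < s -> s <= r -> gbox s z ->
  kball z r `<=` gbox ((2 * N.+1)%:R * r).
Proof.
move=> s0 sr /gboxE[hz tz] w; have r0 := lt_le_trans s0 sr.
have rN : 2 * r <= (2 * N.+1)%:R * r by rewrite natrM ler_pM2r// ler_peMr// ler1n.
move=> /(koranyi_gbox r0)/gboxE; rewrite /heis_mul /heis_inv /= => -[hv tv].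
have hw i : `|w.1 ord0 i| <= 2 * r.
  have := hv i; have := hz i; rewrite !mxE => h1 h2.
  have -> : w.1 ord0 i = z.1 ord0 i + (- z.1 ord0 i + w.1 ord0 i) by ring.
  by apply: le_trans (ler_normD _ _) _; lra.
apply/gboxE; split => [i|]; first exact: le_trans (hw i) rN.
have hz' i : `|(- z.1) ord0 i| <= r by rewrite mxE normrN (le_trans (hz i)).
have r20 : 0 <= 2 * r by rewrite mulr_ge0// ltW.
have := normr_heis_form (ltW r0) r20 hz' hw.
set f := (_ ord0 ord0) in tv *; move=> hf.
(* The translation is undone: the last coordinate of z^-1 w is at most r^2, [z.2] at most s^2 <= r^2
   and [f] at most 4 N^2 r^2, which together stay below (2 (N + 1) r)^2. *)
have -> : w.2 = (- z.2 + w.2 + f) + (z.2 - f) by ring.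
apply: le_trans (ler_normD _ _) _; apply: le_trans (lerD tv (ler_normB _ _)) _.
have s2r2 : s ^+ 2 <= r ^+ 2 by rewrite lerXn2r ?nnegrE// ltW.
apply: le_trans (lerD (lexx _) (lerD (le_trans tz s2r2) hf)) _.
rewrite exprMn natrM -[N.+1%:R]natr1.
have : 0 <= N%:R :> R by []. move: (N%:R : R) => t t0.
have s2 := sqr_ge0 r; rewrite !expr2 in s2 *.
have := mulr_ge0 t0 s2; have := mulr_ge0 (mulr_ge0 t0 t0) s2; lra.
Qed.

End gauge.

(** The intervals of radius [e k] about [a k] meet pairwise, so the supremum of their left ends lies
    in all of them (Helly on the line). This gives the limit together with its rate. *)
Lemma half_cauchy_lim (R : realType) (a e : nat -> R) :
  (forall k l, `|a k - a l| <= e k + e l) ->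
  exists x, forall k, `|a k - x| <= e k.
Proof.
move=> h; pose E := [set a k - e k | k in [set: nat]].
have ubE l : ubound E (a l + e l).
  by move=> _ [k _ <-]; have := h k l; rewrite ler_norml => /andP[_]; lra.
have E0 : E !=set0 by exists (a 0%N - e 0%N), 0%N.
exists (sup E) => k; rewrite ler_distlC; apply/andP; split.
  by apply: ub_le_sup; [exists (a 0%N + e 0%N); exact: ubE|exists k].
by apply: ge_sup => //; exact: ubE.
Qed.

(** * Approximation in measure by affine functions of x *)

Section affine_approximation.
Context {R : realType} {n : nat}.
Local Notation H := (heis R n).
Local Notation mu := (@lebesgue_heis R n).
Local Notation N := (n + n)%N.

Definition affine (c : R) (e : 'rV[R]_N) (z : H) : R :=
  c + \sum_i e ord0 i * z.1 ord0 i.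

Lemma affineB c c' e e' z :
  affine (c - c') (e - e') z = affine c e z - affine c' e' z.
Proof.
rewrite /affine opprD addrACA -sumrB; congr (_ + _).
by apply: eq_bigr => i _; rewrite !mxE mulrBl.
Qed.

Lemma measurable_fun_heis_borel d (T : measurableType d)
    (f : 'rV[R]_N * R -> T) :
  measurable_fun setT f -> measurable_fun [set: H] f.
Proof.
by move=> mf _ Y mY; apply: measurable_heis_borel; exact: mf.
Qed.

Lemma measurable_affine c e : measurable_fun setT (affine c e).
Proof.
apply: measurable_fun_heis_borel; apply: measurable_funD => //.
apply: measurable_sum => i; apply: measurable_funM => //.
apply: (@measurableT_comp _ _ _ _ _ _ (fun v : 'rV[R]_N => v ord0 i)).
  exact: measurable_rV_coor.
exact: measurable_fst.
Qed.

(** Chosen so that [eta * N <= 1/4]: the variation of an affine function over a small box can then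
    be absorbed in [affine_coef_bound]. *)
Let eta : R := (4 * N.+1)%:R^-1.

Let eta_gt0 : 0 < eta. Proof. by rewrite invr_gt0 ltr0n. Qed.

Let eta_le1 : eta <= 1.
Proof. by rewrite invf_le1 ?ltr0n// ler1n. Qed.

Let small_box (a : 'rV[R]_N) : set H := hbox a eta 0 1.

Let mass : R := (2 * eta) ^+ N * (2 * 1).

Let mass_gt0 : 0 < mass.
Proof. by rewrite mulr_gt0// exprn_gt0// mulr_gt0. Qed.

Let mu_small_box a : mu (small_box a) = mass%:E.
Proof. by rewrite lebesgue_hbox// ltW. Qed.

Let small_box_sub (a : 'rV[R]_N) : (forall i, `|a ord0 i| <= 1) -> small_box a `<=` gbox 2.
Proof.
move=> ha z [hz tz]; apply/gboxE; split => [i|].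
  have -> : z.1 ord0 i = (z.1 ord0 i - a ord0 i) + a ord0 i by rewrite subrK.
  apply: le_trans (ler_normD _ _) _.
  have -> : 2 = 1 + 1 :> R by ring.
  by apply: lerD => //; exact: le_trans (hz i) eta_le1.
by move: tz; rewrite subr0 => /le_trans; apply; rewrite -natrX ler1n.
Qed.

Let affine_near (a : 'rV[R]_N) c e z : small_box a z ->
  `|affine c e z - (c + \sum_i e ord0 i * a ord0 i)| <=
  eta * \sum_i `|e ord0 i|.
Proof.
move=> [hz _]; rewrite /affine opprD addrACA subrr add0r -sumrB.
apply: le_trans (ler_norm_sum _ _ _) _; rewrite mulr_sumr.
by apply: ler_sum => i _; rewrite -mulrBr normrM mulrC ler_wpM2r.
Qed.

(** Values near 0 control [c], and values near the i-th basis vector control [c + e_i], up to an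
    error [eta * M] with M the l^1 norm of [e]. Summing the bounds on |e_i| gives eta M <= (2b + 2
    eta M) / 4, hence eta M <= b. *)
Lemma affine_coef_bound (c : R) (e : 'rV[R]_N) (b : R) :
  (exists2 z, small_box 0 z & `|affine c e z| <= b) ->
  (forall i, exists2 z, small_box (delta_mx ord0 i) z & `|affine c e z| <= b) ->
  `|c| <= 4 * b /\ forall i, `|e ord0 i| <= 4 * b.
Proof.
move=> [z0 z0S z0b] hi; pose M : R := \sum_i `|e ord0 i|.
have b0 : 0 <= b by exact: le_trans z0b.
have M0 : 0 <= M by exact: sumr_ge0.
have cb : `|c| <= b + eta * M.
  have := affine_near c e z0S; rewrite big1 ?addr0 => [h|i _]; last first.
    by rewrite mxE mulr0.
  have -> : c = affine c e z0 - (affine c e z0 - c) by ring.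
  by apply: le_trans (ler_normB _ _) _; exact: lerD.
have eb i : `|e ord0 i| <= 2 * b + 2 * (eta * M).
  have [z zS zb] := hi i; have := affine_near c e zS.
  rewrite (bigD1 i)//= big1 ?addr0 => [|j ji]; last first.
    by rewrite mxE (negbTE ji) andbF mulr0.
  rewrite mxE !eqxx mulr1 => h.
  have -> : e ord0 i = affine c e z - (affine c e z - (c + e ord0 i)) - c by ring.
  apply: le_trans (ler_normB _ _) _; apply: le_trans (lerD (ler_normB _ _) cb) _.
  by rewrite -/M in h; lra.
have etaN : eta * N%:R <= 4^-1.
  have : eta * (4 * N.+1)%:R = 1 by rewrite mulVf// pnatr_eq0.
  by rewrite natrM -[N.+1%:R]natr1; have := eta_gt0; lra.
have etaM : eta * M <= b.
  have MN : M <= N%:R * (2 * b + 2 * (eta * M)).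
    rewrite -[in leRHS](card_ord N) mulr_natl -sumr_const.
    by apply: ler_sum => i _; exact: eb.
  have := ler_wpM2l (ltW eta_gt0) MN; rewrite (mulrA eta N%:R) => h.
  have y0 : 0 <= 2 * b + 2 * (eta * M).
    by rewrite addr_ge0 ?mulr_ge0// ltW.
  have := le_trans h (ler_wpM2r y0 etaN); lra.
by split => [|i]; [|have := eb i]; lra.
Qed.

Definition affine_far (u : H -> R) c e (d eps : R) : set H :=
  gbox d `&` [set z | eps <= `|u z - affine c e z|].

Lemma measurable_affine_far u c e d eps : measurable_fun setT u ->
  measurable (affine_far u c e d eps).
Proof.
move=> mu; apply: measurableI; first exact: measurable_gbox.
rewrite (_ : [set z | _] =
    (fun z => `|u z - affine c e z|) @^-1` `[eps, +oo[%classic); last first.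
  by apply/seteqP; split => z /=; rewrite in_itv/= andbT.
rewrite -[X in measurable X]setTI.
have := measurable_funB mu (measurable_affine c e) => mf.
exact: (measurableT_comp (@normr_measurable _ setT) mf).
Qed.

(* If affine functions A_k approximate u in measure on larger and larger boxes,
   then comparing A_k and A_l at points near 0 and near the basis vectors shows
   that their coefficients converge, and u agrees a.e. with the limit. *)
Lemma affine_dichotomy (u : H -> R) : measurable_fun setT u ->
  (exists c e, {ae mu, forall z, u z = affine c e z}) \/
  (exists d eps beta : R, [/\ 2 <= d, 0 < eps, 0 < beta & forall c e,
     (beta%:E <= mu (affine_far u c e d eps))%E]).
Proof.
move=> mu_u; apply: contrapT => /not_orP[hno h].
pose eps k : R := k.+1%:R^-1.
have eps_gt0 k : 0 < eps k by rewrite invr_gt0 ltr0n.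
(* The bound [eps k] makes the measures tend to 0; the bound [mass / 2] prevents two exceptional
   sets from covering a small box. *)
pose beta k : R := Num.min (eps k) (mass / 2).
have beta_gt0 k : 0 < beta k by rewrite lt_min eps_gt0/= divr_gt0.
(* The size [k.+2] makes the boxes exhaust the space while all of them contain the small boxes,
   which lie in [gbox 2]. *)
have /choice[A hA] k : exists A : R * 'rV[R]_N,
    (mu (affine_far u A.1 A.2 k.+2%:R (eps k)) < (beta k)%:E)%E.
  apply: contrapT => hk; apply: h; exists k.+2%:R, (eps k), (beta k).
  split => // [|c e]; first by rewrite ler_nat.
  by rewrite leNgt; apply/negP => hce; apply: hk; exists (c, e).
(* Otherwise each point of the small box would be far from A_k or from A_l, while the two far sets
   have total measure below [mass]. *)
have common k l (a : 'rV[R]_N) : (forall i, `|a ord0 i| <= 1) -> exists2 z, small_box a z &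
    `|affine ((A k).1 - (A l).1) ((A k).2 - (A l).2) z| <= eps k + eps l.
  move=> ha; apply: contrapT => hz.
  have sub : small_box a `<=` affine_far u (A k).1 (A k).2 k.+2%:R (eps k) `|`
                              affine_far u (A l).1 (A l).2 l.+2%:R (eps l).
    move=> z zS; have zk j : gbox j.+2%:R z.
      by apply: subset_gbox (small_box_sub ha zS); rewrite ?ler_nat.
    have [hk|hk] := leP (eps k) `|u z - affine (A k).1 (A k).2 z|; first by left.
    have [hl|hl] := leP (eps l) `|u z - affine (A l).1 (A l).2 z|; first by right.
    exfalso; apply: hz; exists z => //; rewrite affineB.
    set x := affine _ _ z in hk *; set y := affine _ _ z in hl *.
    have -> : x - y = (u z - y) - (u z - x) by ring.
    by rewrite (le_trans (ler_normB _ _))// addrC lerD// ltW.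
  have := le_trans (le_lebesgue_heis sub) (measureU2 mu (measurable_affine_far _ _ _ _ mu_u)
    (measurable_affine_far _ _ _ _ mu_u)).
  rewrite mu_small_box leNgt => /negP; apply.
  apply: lt_le_trans (lteD (hA k) (hA l)) _; rewrite -EFinD lee_fin.
  have : beta k <= mass / 2 by rewrite ge_min lexx orbT.
  have : beta l <= mass / 2 by rewrite ge_min lexx orbT.
  lra.
have close k l : `|(A k).1 - (A l).1| <= 4 * eps k + 4 * eps l /\
    forall i, `|(A k).2 ord0 i - (A l).2 ord0 i| <= 4 * eps k + 4 * eps l.
  have [||hc he] := @affine_coef_bound ((A k).1 - (A l).1) ((A k).2 - (A l).2)
      (eps k + eps l).
  - by apply: common => i; rewrite mxE normr0.
  - move=> i; apply: common => j; rewrite mxE.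
    by case: (_ && _); rewrite ?normr1 ?normr0.
  - rewrite -mulrDr; split => // i.
    by have := he i; rewrite !mxE.
have [c hc] : exists c, forall k, `|(A k).1 - c| <= 4 * eps k.
  by apply: half_cauchy_lim => k l; exact: (close k l).1.
have /choice[e0 he0] i : exists x, forall k, `|(A k).2 ord0 i - x| <= 4 * eps k.
  by apply: half_cauchy_lim => k l; exact: (close k l).2.
apply: hno; exists c, (\row_i e0 i).
(* The set where [u] differs from the limit is covered by the sets [T j]; each is null, being
   contained in the far set of A_k for all large k. *)
pose T j := affine_far u c (\row_i e0 i) j%:R (eps j).
have sub : [set z | ~ u z = affine c (\row_i e0 i) z] `<=` \bigcup_j T j.
  move=> z /eqP; rewrite -subr_eq0 -normr_gt0 => uz.
  have [j1 hj1] := ltr_add_invr uz.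
  have [j2 hj2] : exists j2 : nat, gbox j2%:R z.
    pose M := `|z.2| + \sum_i `|z.1 ord0 i| + 1.
    have S0 : 0 <= \sum_i `|z.1 ord0 i| by exact: sumr_ge0.
    have M1 : 1 <= M by rewrite lerDr addr_ge0.
    have MN : M <= (Num.truncn M).+1%:R by exact/ltW/truncnS_gt.
    exists (Num.truncn M).+1; apply: (@subset_gbox _ _ M) => //.
      exact: le_trans M1.
    apply/gboxE; split => [i|].
      rewrite /M (bigD1 i)//= -addrA -addrA addrCA lerDl addr_ge0// addr_ge0//.
      exact: sumr_ge0.
    apply: (@le_trans _ _ M); first by rewrite /M -addrA lerDl addr_ge0.
    by rewrite expr2 ler_peMl// (le_trans _ M1).
  exists (maxn j1 j2) => //; split.
    by apply: subset_gbox hj2 => //; rewrite ler_nat leq_maxr.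
  rewrite /= (le_trans _ (ltW hj1))// add0r lef_pV2 ?posrE ?ltr0n//.
  by rewrite ler_nat ltnS leq_maxl.
suff T0 j : mu (T j) = 0%E.
  apply: negligibleS sub _; apply: negligible_bigcup => j.
  by exists (T j); split; [exact: measurable_affine_far|exact: T0|].
(* On the box of size j, A_k is within eps_k (4 + 4 N j) of the limit. From [k0] on, this error plus
   one more eps_k is at most eps_j, so a point of [T j] is at distance at least eps_k from A_k;
   hence the 5. *)
pose k0 := (j.+1 * (5 + 4 * (N * j)))%N.
have Tle k : (k0 <= k)%N -> (mu (T j) <= (eps k)%:E)%E.
  move=> k0k; apply: (@le_trans _ _ (beta k)%:E); last first.
    by rewrite lee_fin ge_min lexx.
  apply: le_trans (ltW (hA k)); apply: le_lebesgue_heis => z [jz hz].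
  have jk : (j <= k)%N.
    by apply: (leq_trans _ k0k); exact: leq_trans (leqnSn j) (leq_pmulr _ _).
  split; first by apply: subset_gbox jz => //; rewrite ler_nat (leq_trans jk)// leqW.
  have Ak : `|affine (A k).1 (A k).2 z - affine c (\row_i e0 i) z| <=
      4 * eps k + N%:R * (4 * eps k * j%:R).
    rewrite -affineB /affine; apply: le_trans (ler_normD _ _) _.
    apply: lerD; first exact: hc.
    apply: le_trans (ler_norm_sum _ _ _) _.
    rewrite -[in leRHS](card_ord N) mulr_natl -sumr_const.
    apply: ler_sum => i _; rewrite normrM; apply: ler_pM => //.
      by rewrite !mxE; exact: he0.
    by have /gboxE[] := jz.
  have epsj : eps k * (5 + 4 * (N%:R * j%:R)) <= eps j.
    rewrite /eps mulrC ler_pdivrMr ?ltr0n// [leRHS]mulrC ler_pdivlMr ?ltr0n//.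
    rewrite -natrM -natrM -natrD -natrM ler_nat mulnC.
    exact: leq_trans (leqnSn k).
  move: hz => /=; set x := affine _ _ z in Ak *; set y := affine _ _ z in Ak *.
  have : `|u z - y| <= `|u z - x| + `|x - y|.
    have -> : u z - y = (u z - x) + (x - y) by ring.
    exact: ler_normD.
  move: Ak epsj; move: `|_| `|_| `|_| => r1 r2 r3; nra.
apply/eqP; rewrite eq_le measure_ge0 andbT; apply/lee_addgt0Pr => x x0.
have [k1 hk1] := ltr_add_invr x0.
apply: le_trans (Tle (maxn k0 k1) (leq_maxl _ _)) _.
rewrite add0e lee_fin (le_trans _ (ltW hk1))// add0r lef_pV2 ?posrE ?ltr0n//.
by rewrite ler_nat ltnS leq_maxr.
Qed.

End affine_approximation.

(** * Polynomials of homogeneous degree at most 1 *)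

Section first_degree_polynomials.
Context {R : realType} {n : nat}.
Local Notation H := (heis R n).
Local Notation C := R[i].
Local Notation N := (n + n)%N.

Lemma affine0 (z : H) : affine 0 0 z = 0.
Proof. by rewrite /affine add0r big1// => i _; rewrite mxE mul0r. Qed.

Lemma affineD c c' e e' (z : H) :
  affine (c + c') (e + e') z = affine c e z + affine c' e' z.
Proof.
rewrite /affine addrACA -big_split/=; congr (_ + _).
by apply: eq_bigr => i _; rewrite !mxE mulrDl.
Qed.

Lemma affineZ a c e (z : H) : affine (a * c) (a *: e) z = a * affine c e z.
Proof.
rewrite /affine mulrDr mulr_sumr; congr (_ + _).
by apply: eq_bigr => i _; rewrite !mxE mulrA.
Qed.

(** As t has weight 2, only the constant monomial and the coordinates x_i have degree at most 1. *)
Lemma monomial_affine (I : @multiindex n) : (hdeg I <= 1)%N ->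
  exists c e, forall z : H, monomial I z = affine c e z.
Proof.
case: I => f k; rewrite /hdeg /= => fk.
have k0 : k = 0%N by case: k fk => // k; rewrite mulnS addnCA.
subst k; rewrite muln0 addn0 in fk.
have [i fi|f0] := pickP (fun i => f i != 0%N).
  move: fk; rewrite (bigD1 i)//=.
  case fiE : (f i) => [|[|m]]; rewrite ?fiE// in fi * => fk.
  have /eqP : (\sum_(j < N | j != i) f j = 0)%N.
    by move: fk; case: (\sum_(_ | _) _)%N.
  rewrite sum_nat_eq0 => /forallP f0.
  exists 0, (delta_mx ord0 i) => z.
  rewrite /monomial /affine /= expr0 mulr1 add0r.
  rewrite (bigD1 i)//= fiE expr1 big1 ?mulr1; last first.
    by move=> j ji; have := f0 j; rewrite ji => /eqP ->.
  rewrite (bigD1 i)//= mxE !eqxx mul1r big1 ?addr0// => j ji.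
  by rewrite mxE (negbTE ji) andbF mul0r.
exists 1, 0 => z; rewrite /monomial /affine /= expr0 mulr1 !big1 ?addr0// => i _.
  by rewrite mxE mul0r.
by have /negbFE/eqP -> := f0 i.
Qed.

(** Separates real and imaginary parts, so that [affine_dichotomy] can be applied to each. *)
Lemma heis_poly1P (P : H -> C) : heis_poly 1 P <->
  exists c e c' e', forall z, P z = (affine c e z +i* affine c' e' z)%C.
Proof.
split=> [[s [coef [hs hP]]]|[c [e [c' [e' hP]]]]].
  suff [c [e [c' [e' h]]]] : exists c e c' e', forall z : H,
      \sum_(I <- s) coef I * (monomial I z)%:C%C =
        (affine c e z +i* affine c' e' z)%C.
    by exists c, e, c', e' => z; rewrite hP.
  elim: s hs {hP} => [|I s IHs] hs.
    by exists 0, 0, 0, 0 => z; rewrite big_nil affine0.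
  have [|c [e [c' [e' h]]]] := IHs.
    by move=> J Js; apply: hs; rewrite inE Js orbT.
  have [|b [f hb]] := @monomial_affine I; first by rewrite hs// mem_head.
  case hI : (coef I) => [x y].
  exists (x * b + c), (x *: f + e), (y * b + c'), (y *: f + e') => z.
  rewrite big_cons h !affineD !affineZ hI hb.
  by apply/eqP; rewrite eq_complex /= !mulr0 subr0 add0r !eqxx.
pose I0 : @multiindex n := ([ffun=> 0%N], 0%N).
pose Ix (i : 'I_N) : @multiindex n := ([ffun j => (j == i) : nat], 0%N).
have Ixinj i j : (Ix i == Ix j) = (i == j).
  apply/eqP/eqP => [[]/ffunP/(_ i)|->//]; rewrite !ffunE eqxx.
  by case: (i =P j).
have Ix0 i : (Ix i == I0) = false.
  by apply/negP => /eqP[]/ffunP/(_ i); rewrite !ffunE eqxx.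
exists (I0 :: [seq Ix i | i <- enum 'I_N]).
(* The sum over i selects the coefficient of the only i with [I = Ix i], as [Ix] is injective and
   avoids [I0]. *)
exists (fun I => if I == I0 then (c +i* c')%C else
  \sum_i if I == Ix i then (e ord0 i +i* e' ord0 i)%C else 0).
split => [I|z].
  rewrite inE => /orP[/eqP ->|/mapP[i _ ->]]; rewrite /hdeg /=.
    by rewrite big1 ?muln0// => i _; rewrite ffunE.
  rewrite (bigD1 i)//= ffunE eqxx big1 ?muln0// => j /negbTE ji.
  by rewrite ffunE ji.
rewrite hP big_cons eqxx big_map big_enum/=.
have -> : monomial I0 z = 1.
  by rewrite /monomial /= big1 ?mulr1// => i _; rewrite ffunE.
rewrite mulr1.
under eq_bigr => i _.
  rewrite Ix0 (bigD1 i)//= eqxx big1 ?addr0; last first.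
    by move=> j /negbTE ji; rewrite Ixinj eq_sym ji.
  have -> : monomial (Ix i) z = z.1 ord0 i.
    rewrite /monomial /= (bigD1 i)//= ffunE eqxx expr1 big1 ?mulr1// => j /negbTE ji.
    by rewrite ffunE ji.
  over.
rewrite /affine; elim/big_rec3: _ => [|i x y w _ h]; first by rewrite !addr0.
rewrite [RHS]addrCA -h; apply/eqP; rewrite eq_complex /= !mulr0 subr0 add0r.
by apply/andP; split; apply/eqP; ring.
Qed.

End first_degree_polynomials.

(** * Lower bounds for integrals of nonnegative functions *)

Section nonneg_integral.
Context d (T : measurableType d) (R : realType) (m : {measure set T -> \bar R}).
Local Open Scope ereal_scope.

(* [ge0_le_integral] without the measurability hypotheses. *)
Lemma ge0_le_integral_nonmeasurable (f g : T -> \bar R) :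
  (forall x, 0 <= f x) -> (forall x, f x <= g x) ->
  \int[m]_x f x <= \int[m]_x g x.
Proof.
move=> f0 fg; rewrite !ge0_integralTE//; last first.
  by move=> x; exact: le_trans (fg x).
apply: le_ereal_sup => _ [h /= hf <-].
by exists h => // x; exact: le_trans (fg x).
Qed.

(** The simple function c 1_E lies below [f] extended by 0 off [B]. With [B] a Koranyi ball this
    bounds the averages from below. *)
Lemma markov_nonmeasurable (f : T -> \bar R) (B E : set T) (c : R) :
  measurable E -> E `<=` B -> (0 <= c)%R -> (forall x, 0 <= f x) ->
  (forall x, E x -> c%:E <= f x) -> c%:E * m E <= \int[m]_(x in B) f x.
Proof.
move=> mE EB c0 f0 cf; rewrite [leRHS]integral_mkcond.
rewrite -[E in m E]setIT -integral_indic// -ge0_integralZl//; last first.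
- exact/measurable_EFinP.
apply: ge0_le_integral_nonmeasurable => x.
  by rewrite mule_ge0// lee_fin.
rewrite /patch indicE; have [xE|xE] := boolP (x \in E).
  rewrite mem_set; last exact/EB/set_mem.
  by rewrite mule1 cf//; exact: set_mem.
by rewrite mule0; case: ifP.
Qed.

End nonneg_integral.

(** * Nonzero classes modulo P_1 *)

Section classes.
Context {R : realType} {n : nat}.
Local Notation H := (heis R n).
Local Notation C := R[i].
Local Notation mu := (@lebesgue_heis R n).
Local Notation N := (n + n)%N.

Lemma normc_ge_part (x : C) :
  `|complex.Re x| <= Normc.normc x /\ `|complex.Im x| <= Normc.normc x.
Proof.
case: x => a b /=; split; rewrite -sqrtr_sqr ler_sqrt ?addr_ge0 ?sqr_ge0//.
  by rewrite lerDl sqr_ge0.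
by rewrite lerDr sqr_ge0.
Qed.

Lemma le_mu_ae (A B : set H) : measurable A -> measurable B ->
  {ae mu, forall z, A z -> B z} -> (mu A <= mu B)%E.
Proof.
move=> mA mB [D [mD D0 hD]].
rewrite -[leRHS]adde0 -D0; apply: le_trans (measureU2 mu mB mD).
apply: le_lebesgue_heis => z Az; apply: contrapT => /not_orP[nB nD].
by apply: nD; apply: hD => /= h; apply: nB; exact: h.
Qed.

(** [affine_dichotomy] is applied to both parts of [g0]. If both are affine a.e., then [g0] agrees
    a.e. with an element of P_1. Otherwise one part stays far from every affine function, and |g|
    dominates the same part of g. *)
Lemma classE1_dichotomy (q : R) (g0 : H -> C) : Lqloc q g0 ->
  classE1 q g0 = zeroE1 q \/
  exists d eps beta : R, [/\ 2 <= d, 0 < eps, 0 < beta & forall g, classE1 q g0 g ->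
    exists E : set H, [/\ measurable E, E `<=` gbox d,
      forall z, E z -> eps <= Normc.normc (g z) & (beta%:E <= mu E)%E]].
Proof.
move=> [[mre mim] _].
(* Treats real and imaginary parts together: [pr] is the projection and [u] is [pr] of [g0]. *)
have part (u : H -> R) (pr : C -> R) :
    measurable_fun setT u -> (forall x, `|pr x| <= Normc.normc x) ->
    (forall g, classE1 q g0 g -> measurable_fun setT (fun z => pr (g z)) /\
      exists c e, {ae mu, forall z, pr (g z) = u z - affine c e z}) ->
    (exists c e, {ae mu, forall z, u z = affine c e z}) \/
    exists d eps beta : R, [/\ 2 <= d, 0 < eps, 0 < beta & forall g, classE1 q g0 g ->
    exists E : set H, [/\ measurable E, E `<=` gbox d,
      forall z, E z -> eps <= Normc.normc (g z) & (beta%:E <= mu E)%E]].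
  move=> mu_u lepr hpr; have [|[d [eps [beta [d2 eps0 beta0 h]]]]] := affine_dichotomy mu_u.
    by left.
  right; exists d, eps, beta; split => // g /hpr[mg [c [e hg]]].
  (* The distance of [pr g] from 0 is a.e. the distance of [u] from [affine c e], so the lower bound
     on the measure carries over. *)
  exists (affine_far (fun z => pr (g z)) 0 0 d eps); split.
  - exact: measurable_affine_far.
  - by move=> z [].
  - move=> z [_ /=]; rewrite affine0 subr0.
    by move=> /le_trans; apply.
  - apply: le_trans (h c e) _; apply: le_mu_ae; try exact: measurable_affine_far.
    apply: filterS hg => z hz [zd /= zu]; split => //=.
    by rewrite hz affine0 subr0.
have [||[c [e hc]]|] := part (fun z => complex.Re (g0 z)) (@complex.Re R) mre; last by right.
- by move=> x; have [] := normc_ge_part x.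
- move=> g [[[mg _] _] [P /heis_poly1P[c [e [c' [e' hP]]]] hg]]; split => //.
  exists (- c), (- e); apply: filterS hg => z ->; rewrite hP.
  rewrite -[- c]sub0r -[- e]sub0r affineB; case: (g0 z) => a b /=.
  by rewrite affine0 sub0r opprK.
have [||[c' [e' hc']]|] := part (fun z => complex.Im (g0 z)) (@complex.Im R) mim; last by right.
- by move=> x; have [] := normc_ge_part x.
- move=> g [[[_ mg] _] [P /heis_poly1P[b [f [b' [f' hP]]]] hg]]; split => //.
  exists (- b'), (- f'); apply: filterS hg => z ->; rewrite hP.
  rewrite -[- b']sub0r -[- f']sub0r affineB; case: (g0 z) => a a' /=.
  by rewrite affine0 sub0r opprK.
(* The affine function equal to [g0] a.e. is added to the polynomial for one inclusion and
   subtracted for the other. *)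
left; apply/seteqP; split => g [Lg [P /heis_poly1P[b [f [b' [f' hP]]]] hg]]; split => //.
  exists (fun z => (affine (c + b) (e + f) z +i* affine (c' + b') (e' + f') z)%C).
    by apply/heis_poly1P; exists (c + b), (e + f), (c' + b'), (e' + f').
  apply: filterS3 hg hc hc' => z -> /= h1 h2; rewrite hP.
  case: (g0 z) h1 h2 => a a' /= -> ->.
  by apply/eqP; rewrite eq_complex /= !affineD !add0r !eqxx.
exists (fun z => (affine (b - c) (f - e) z +i* affine (b' - c') (f' - e') z)%C).
  by apply/heis_poly1P; exists (b - c), (f - e), (b' - c'), (f' - e').
apply: filterS3 hg hc hc' => z -> /= h1 h2; rewrite hP.
case: (g0 z) h1 h2 => a a' /= -> ->.
by apply/eqP; rewrite eq_complex /= !affineB !add0r !subrKC !eqxx.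
Qed.

End classes.

(** * Decay of the maximal function is no faster than s^-(2 + Q/q) *)

Section maximal_function.
Context {R : realType} {n : nat}.
Local Notation H := (heis R n).
Local Notation C := R[i].
Local Notation mu := (@lebesgue_heis R n).
Local Notation N := (n + n)%N.
Local Notation Q := (hom_dim n).

(** The supremum is tested at the single radius [kap * s]. That ball contains [E] and has measure at
    most D s^Q, so the mean of |g|^q is at least eps^q beta / (D s^Q); the q-th root and the factor
    r^-2 give the exponent. The constant is fixed before [g], so that it survives the infimum in
    [N2]. *)
Lemma eta2_lower_bound (q d eps beta : R) : 1 < q -> 1 <= d -> 0 < eps -> 0 < beta ->
  exists2 c1 : R, 0 < c1 & forall (g : H -> C) (E : set H) (s : R) (z : H),
    measurable E -> E `<=` gbox d -> (forall z, E z -> eps <= Normc.normc (g z)) ->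
    (beta%:E <= mu E)%E -> d <= s -> gbox s z ->
    ((c1 * s `^ (- (2 + Q%:R / q)))%:E <= eta2 q g z)%E.
Proof.
move=> q1 d1 eps0 beta0.
(* [L] is the dilation in [kball_sub_gbox], [kap * s] the radius in [gbox_sub_kball], and [D] the
   measure of [gbox (L * kap)]. *)
pose L : R := (2 * N.+1)%:R.
have L1 : 1 <= L by rewrite ler1n.
pose kap : R := N.+2%:R * L.
have kap1 : 1 <= kap by rewrite mulr_ege1// ler1n.
have L0 : 0 < L := lt_le_trans ltr01 L1.
have kap0 : 0 < kap := lt_le_trans ltr01 kap1.
pose D : R := 2 ^+ N.+1 * (L * kap) ^+ Q.
have D0 : 0 < D by rewrite mulr_gt0 ?exprn_gt0 ?mulr_gt0.
have b0 : 0 < eps `^ q * beta by rewrite mulr_gt0 ?powR_gt0.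
exists (kap ^- 2 * (D^-1 * (eps `^ q * beta)) `^ q^-1).
  by rewrite mulr_gt0 ?invr_gt0 ?exprn_gt0 ?powR_gt0 ?mulr_gt0 ?invr_gt0 ?powR_gt0.
move=> g E s z mE Ed gE bE ds zs.
have s0 : 0 < s by rewrite (lt_le_trans ltr01)// (le_trans d1).
pose r := kap * s; have r0 : 0 < r by rewrite mulr_gt0.
have sr : s <= r by rewrite ler_peMl// ltW.
pose B := kball z r.
have sB : gbox s `<=` B.
  by move=> w /(gbox_sub_kball s0 zs); rewrite /B /r /kap mulrA.
have EB : E `<=` B.
  by move=> w /Ed hw; apply: sB; apply: subset_gbox hw => //; exact: le_trans d1.
have muB : (mu B <= (D * s ^+ Q)%:E)%E.
  apply: le_trans (le_lebesgue_heis (kball_sub_gbox s0 sr zs)) _.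
  rewrite lebesgue_gbox; last by rewrite mulr_ge0 ?ltW.
  by rewrite lee_fin /r /D -mulrA -exprMn mulrA.
have Ds0 : 0 < D * s ^+ Q by rewrite mulr_gt0// exprn_gt0.
have muBV : (((D * s ^+ Q)^-1)%:E <= (mu B)^-1)%E.
  have -> : ((D * s ^+ Q)^-1)%:E = (D * s ^+ Q)%:E^-1%E.
    by rewrite inver gt_eqF.
  by rewrite lee_pV2// inE/= ?measure_ge0// lee_fin ltW.
have intB : ((eps `^ q * beta)%:E <=
    \int[mu]_(w in B) (Normc.normc (g w) `^ q)%:E)%E.
  apply: (@le_trans _ _ ((eps `^ q)%:E * mu E)%E).
    by rewrite EFinM lee_pmul2l// lte_fin powR_gt0.
  apply: markov_nonmeasurable => //; first exact: powR_ge0.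
    by move=> w; rewrite lee_fin powR_ge0.
  move=> w /gE hw; rewrite lee_fin ge0_ler_powR ?nnegrE//.
  - by rewrite ltW// (lt_trans ltr01).
  - exact: ltW.
  - by rewrite (le_trans _ hw)// ltW.
have avgB : ((((D * s ^+ Q)^-1 * (eps `^ q * beta)) `^ q^-1)%:E <= avgq q g B)%E.
  have le0 : (0 <= ((D * s ^+ Q)^-1 * (eps `^ q * beta))%:E)%E.
    by rewrite lee_fin mulr_ge0 ?invr_ge0 ?ltW.
  have le1 : (((D * s ^+ Q)^-1 * (eps `^ q * beta))%:E <=
    (mu B)^-1 * \int[mu]_(w in B) (Normc.normc (g w) `^ q)%:E)%E.
    rewrite EFinM; apply: lee_pmul => //; by rewrite lee_fin ltW// invr_gt0.
  rewrite -poweR_EFin /avgq; apply: gt0_ler_poweR => //.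
  - by rewrite invr_ge0 ltW// (lt_trans ltr01).
  - by rewrite in_itv/= le0 leey.
  - by rewrite in_itv/= (le_trans le0 le1) leey.
apply: (@le_trans _ _ ((r ^- 2)%:E * avgq q g B)%E); last first.
  by apply: ereal_sup_ubound; exists r.
apply: le_trans (lee_pmul _ _ (lexx _) avgB); last 2 first.
- by rewrite lee_fin invr_ge0 exprn_ge0// ltW.
- by rewrite lee_fin powR_ge0.
rewrite -EFinM lee_fin /r; clearbody D kap.
rewrite exprMn !(invfM D) (invfM (kap ^+ 2)).
have q0 : 0 < q by exact: lt_trans q1.
have -> : s `^ (- (2 + Q%:R / q)) = s ^- 2 * (s ^- Q) `^ q^-1.
  rewrite opprD powRD; last by rewrite (gt_eqF s0) implybT.
  rewrite !powRN -powR_mulrn ?(ltW s0)//.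
  by rewrite -[s ^- Q]powR_invn -?powRrM ?ltW// mulNr powRN.
have -> : (D^-1 * s ^- Q * (eps `^ q * beta)) `^ q^-1 =
    (D^-1 * (eps `^ q * beta)) `^ q^-1 * (s ^- Q) `^ q^-1.
  rewrite -powRM; first by congr (_ `^ _); ring.
    by rewrite mulr_ge0 ?invr_ge0// ltW.
  by rewrite invr_ge0 exprn_ge0// ltW.
by rewrite le_eqVlt; apply/orP; left; apply/eqP; ring.
Qed.

Lemma N2_lower_bound (q : R) (g0 : H -> C) : 1 < q -> Lqloc q g0 ->
  classE1 q g0 <> zeroE1 q ->
  exists d c1 : R, [/\ 1 <= d, 0 < c1 & forall s z, d <= s -> gbox s z ->
    ((c1 * s `^ (- (2 + Q%:R / q)))%:E <= N2 q (classE1 q g0) z)%E].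
Proof.
move=> q1 Lg0 G0; have [/G0//|[d [eps [beta [d2 eps0 beta0 h]]]]] := classE1_dichotomy Lg0.
have d1 : 1 <= d by apply: le_trans d2; rewrite ler1n.
have [c1 c10 hc1] := eta2_lower_bound q1 d1 eps0 beta0.
exists d, c1; split => // s z ds zs; apply: le_ereal_inf_tmp => _ [g Gg <-].
have [E [mE Ed gE bE]] := h g Gg.
exact: (hc1 g E).
Qed.

End maximal_function.

(** * Divergence of the modular *)

Section modular.
Context {R : realType} {n : nat}.
Local Notation H := (heis R n).
Local Notation mu := (@lebesgue_heis R n).
Local Notation N := (n + n)%N.
Local Notation Q := (hom_dim n).

Lemma powR_ler_exponent (b x y : R) : 0 < b -> b <= 1 -> x <= y -> b `^ y <= b `^ x.
Proof.
move=> b0 b1 xy; have e t : b `^ t = b^-1 `^ (- t).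
  by rewrite -powR_inv1 ?ltW// -powRrM mulrNN mul1r.
by rewrite !e ler_powR ?invf_ge1// lerN2.
Qed.

(** On the k-th dyadic annulus |f|^p >= (c1 s^-a)^P = c1^P s^-Q for s = s_(k+1), because a P = Q.
    The annulus has measure at least 2^N s^Q, so the powers of s cancel and each annulus contributes
    at least [kap]. *)
Lemma modular_pinfty (p : H -> R) (f : H -> \bar R) (a P d c : R) :
  measurable_fun setT p -> (forall z, 0 < p z) ->
  {ae mu, forall z, p z <= P} -> 0 < a -> a * P = Q%:R -> 1 <= d -> 0 < c ->
  (forall s z, d <= s -> gbox s z -> ((c * s `^ (- a))%:E <= f z)%E) ->
  modular p f = +oo%E.
Proof.
move=> mp p0 pP a0 aP d1 c0 hf.
have P0 : 0 <= P by rewrite -(pmulr_rge0 _ a0) aP.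
have d0 : 0 < d by exact: lt_le_trans d1.
(* With [c1 <= 1] the base c1 s^-a is at most 1, so raising the exponent from [p z] to [P] only
   decreases the power. *)
pose c1 : R := Num.min c 1.
have c10 : 0 < c1 by rewrite lt_min c0 ltr01.
pose s k : R := d * 2 ^+ k.
have s1 k : 1 <= s k by rewrite mulr_ege1// exprn_ege1// ler1n.
have s0 k : 0 < s k := lt_le_trans ltr01 (s1 k).
have ds k : d <= s k by rewrite ler_peMr ?exprn_ege1 ?ler1n// ltW.
have sS k : s k.+1 = 2 * s k by rewrite /s exprS; ring.
have subS k : gbox (s k) `<=` (gbox (s k.+1) : set H).
  by apply: subset_gbox; [exact: ltW|rewrite sS ler_peMl ?ler1n ?(ltW (s0 k))].
(* Intersecting the annuli with [D] makes the a.e. bound on [p] pointwise and costs no measure. *)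
pose D : set H := [set z | p z <= P].
have mD : measurable D.
  rewrite (_ : D = p @^-1` `]-oo, P]%classic); last first.
    by apply/seteqP; split => z /=; rewrite in_itv.
  by rewrite -[X in measurable X]setTI; exact: mp.
pose A k := (gbox (s k.+1) `\` gbox (s k)) `&` D.
have mS k : measurable (gbox (s k.+1) `\` gbox (s k) : set H).
  by apply: measurableD; exact: measurable_gbox.
have mA k : measurable (A k) by exact: measurableI.
pose al k : R := c1 `^ P * s k.+1 ^- Q.
have al0 k : 0 <= al k by rewrite mulr_ge0 ?powR_ge0// invr_ge0 exprn_ge0// ltW.
pose phi z : \bar R := (`|f z| `^ p z)%E.
have phi0 z : (0 <= phi z)%E by exact: poweR_ge0.
have alphi k z : A k z -> ((al k)%:E <= phi z)%E.
  move=> [[zk _] /= zD].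
  have le1 : s k.+1 `^ (- a) <= 1.
    rewrite -(powRr0 (s k.+1)) ler_powR// oppr_le0 ltW//.
  pose b := c1 * s k.+1 `^ (- a).
  have b0 : 0 < b by rewrite mulr_gt0// powR_gt0.
  have b1 : b <= 1.
    by rewrite /b -[leRHS]mulr1 ler_pM ?powR_ge0 ?(ltW c10)// ge_min lexx orbT.
  have bf : (b%:E <= `|f z|)%E.
    apply: le_trans (lee_abs _); apply: le_trans (hf _ _ (ds _) zk).
    by rewrite lee_fin ler_wpM2r ?powR_ge0// ge_min lexx.
  have -> : al k = b `^ P.
    rewrite /al /b powRM ?powR_ge0 ?(ltW c10)//; congr (_ * _).
    by rewrite -powRrM mulNr aP powRN powR_mulrn// ltW.
  apply: (@le_trans _ _ (b `^ p z)%:E); first by rewrite lee_fin powR_ler_exponent.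
  rewrite -poweR_EFin; apply: gt0_ler_poweR => //.
  - exact: ltW.
  - by rewrite in_itv/= lee_fin (ltW b0) leey.
  - by rewrite in_itv/= abse_ge0 leey.
pose F K z : \bar R := (\sum_(k < K) (al k)%:E * (\1_(A k) z)%:E)%E.
have F0 K z : (0 <= F K z)%E.
  by apply: sume_ge0 => k _; rewrite mule_ge0// lee_fin.
(* The second clause carries the disjointness of the annuli through the induction: [A K] lies
   outside [gbox (s K)], where all earlier terms vanish. *)
have Fphi K z : (F K z <= phi z)%E /\ (~ gbox (s K) z -> (F K z <= 0)%E).
  elim: K => [|K [IH1 IH2]]; first by rewrite /F big_ord0.
  rewrite /F big_ord_recr/= -/(F K z) indicE.
  have [/set_mem zA|zA] := boolP (z \in A K); last first.
    rewrite mule0 adde0; split => // zK; apply: IH2 => h; apply: zK.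
    exact: subS.
  have [[zK nzK] _] := zA; rewrite mule1; split => //.
  by rewrite -[leRHS]add0e leeD// ?IH2// alphi.
have muA k : ((2 ^+ N * s k.+1 ^+ Q)%:E <= mu (A k))%E.
  apply: (@le_trans _ _ (mu (gbox (s k.+1) `\` gbox (s k)))); last first.
    by apply: le_mu_ae => //; apply: filterS pP => z zP zS; split.
  have fin : (mu (gbox (s k.+1)) < +oo)%E by rewrite lebesgue_gbox ?ltry// ltW.
  have -> : (mu (gbox (s k.+1) `\` gbox (s k)) =
      mu (gbox (s k.+1)) - mu (gbox (s k)))%E.
    rewrite -[in RHS](setIidr (subS k)).
    by apply: measureD => //; exact: measurable_gbox.
  rewrite !lebesgue_gbox ?(ltW (s0 _))// -EFinB lee_fin sS exprMn.
  (* Since Q >= 1, the inner box has at most half the measure of the outer one. *)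
  have : 2 * s k ^+ Q <= 2 ^+ Q * s k ^+ Q.
    rewrite ler_wpM2r ?exprn_ge0 ?(ltW (s0 k))// /hom_dim addn2 exprS.
    by rewrite ler_peMr// exprn_ege1// ler1n.
  have h2 : 0 <= 2 ^+ N :> R by exact: exprn_ge0.
  move=> /(ler_wpM2l h2); rewrite (exprS 2 N); lra.
pose kap : R := c1 `^ P * 2 ^+ N.
have kap0 : 0 < kap by rewrite mulr_gt0 ?powR_gt0 ?exprn_gt0.
have low K : ((K%:R * kap)%:E <= modular p f)%E.
  apply: (@le_trans _ _ (\int[mu]_z F K z)%E); last first.
    by apply: ge0_le_integral_nonmeasurable => // z; exact: (Fphi K z).1.
  rewrite ge0_integral_sum//; last 2 first.
  - move=> k; apply: measurable_funeM; exact/measurable_EFinP.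
  - by move=> k z _; rewrite mule_ge0// lee_fin.
  rewrite (_ : (K%:R * kap)%:E = \sum_(k < K) kap%:E)%E; last first.
    by rewrite sumEFin sumr_const card_ord mulr_natl.
  apply: lee_sum => k _.
  rewrite ge0_integralZl ?lee_fin//; last exact/measurable_EFinP.
  rewrite integral_indic// setIT.
  apply: le_trans (lee_pmul _ _ (lexx _) (muA k)); last 2 first.
  - by rewrite lee_fin.
  - by rewrite lee_fin mulr_ge0 ?exprn_ge0// ltW.
  rewrite -EFinM lee_fin /kap /al le_eqVlt; apply/orP; left; apply/eqP.
  rewrite -mulrA; congr (_ * _).
  by rewrite mulrCA mulVf ?mulr1// expf_neq0// gt_eqF.
apply/eqyP => x x0.
apply: le_trans (low (Num.truncn (x / kap)).+1); rewrite lee_fin -ler_pdivrMr//.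
exact/ltW/truncnS_gt.
Qed.

End modular.

(** * The zero class belongs to the space *)

Section zero_class.
Context {R : realType} {n : nat}.
Local Notation H := (heis R n).
Local Notation C := R[i].
Context (q : R) (q1 : 1 < q).

Let q_neq0 : q != 0. Proof. by rewrite gt_eqF// (lt_trans ltr01). Qed.

Lemma normc0_powR : Normc.normc (0 : C) `^ q = 0.
Proof. by rewrite Normc.normc0 powR0. Qed.

Lemma Lqloc0 : @Lqloc R n q (fun=> 0).
Proof.
split; first by split; exact: measurable_cst.
by move=> K _; rewrite integral0_eq// => z _; rewrite normc0_powR.
Qed.

Lemma eta2_ge0 (g : H -> C) z : (0 <= eta2 q g z)%E.
Proof.
apply: (@le_trans _ _ ((1 ^- 2)%:E * avgq q g (kball z 1))%E).
  by rewrite mule_ge0 ?poweR_ge0// lee_fin invr_ge0 exprn_ge0.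
by apply: ereal_sup_ubound; exists 1 => //=.
Qed.

Lemma eta2_0 (z : H) : eta2 q (fun=> 0) z = 0%E.
Proof.
apply/eqP; rewrite eq_le eta2_ge0 andbT; apply: ge_ereal_sup => _ [r _ <-].
rewrite /avgq integral0_eq; last by move=> w _; rewrite normc0_powR.
(* The exponent [q^-1] must be nonzero here, as 0 to the power 0 is 1. *)
by rewrite mule0 poweR0r ?invr_eq0// mule0.
Qed.

Lemma zeroE1_0 : @zeroE1 R n q (fun=> 0).
Proof.
split; first exact: Lqloc0.
exists (fun=> 0); last by apply: nearW => z; rewrite addr0.
by exists [::], (fun=> 0); split => // z; rewrite big_nil.
Qed.

Lemma N2_zeroE1 : N2 q (@zeroE1 R n q) = cst 0%E.
Proof.
apply/funext => z; apply/eqP; rewrite eq_le; apply/andP; split.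
  by apply: ereal_inf_lbound; exists (fun=> 0); [exact: zeroE1_0|exact: eta2_0].
by apply: le_ereal_inf_tmp => _ [g _ <-]; exact: eta2_ge0.
Qed.

Lemma calderon_hardy_zeroE1 (p : H -> R) :
  (forall z, 0 < p z) -> calderon_hardy p q (zeroE1 q).
Proof.
move=> p0; split; first by exists (fun=> 0); first exact: Lqloc0.
rewrite N2_zeroE1; split; first exact: measurable_cst.
exists 1; rewrite ?ltr01// /modular integral0_eq// => z _.
by rewrite mule0 abse0 poweR0r// gt_eqF.
Qed.

End zero_class.

Theorem theorem23 (R : realType) (n : nat) (q : R) (p : heis R n -> R) :
  (1 <= n)%N ->
  1 < q ->
  is_exponent p ->
  (0 < p_minus p)%E ->
  (p_minus p <= p_plus p)%E ->
  (p_plus p < +oo)%E ->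
  (p_plus p <= ((hom_dim n)%:R * (2 + (hom_dim n)%:R / q)^-1)%:E)%E ->
  calderon_hardy p q = [set zeroE1 q].
Proof.
move=> _ q1 [mp p0] _ _ _ /ess_supP pP.
apply/seteqP; split => [G [[g0 Lg0 <-] [_ [lam lam0 fin]]]|_ ->]; last first.
  exact: calderon_hardy_zeroE1.
apply: contrapT => /= G0.
have [d [c1 [d1 c10 hN]]] := N2_lower_bound q1 Lg0 G0.
have a0 : 0 < 2 + (hom_dim n)%:R / q.
  by rewrite ltr_pwDl// divr_ge0// ltW// (lt_trans ltr01).
(* With a = 2 + Q/q and P = Q/a the product a P is exactly Q; the scaling by [lam^-1] only changes
   the constant in the lower bound. *)
move: fin; rewrite (@modular_pinfty _ _ _ _ (2 + (hom_dim n)%:R / q)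
  ((hom_dim n)%:R * (2 + (hom_dim n)%:R / q)^-1) d (lam^-1 * c1))//.
- by rewrite mulrCA mulfV ?mulr1// gt_eqF.
- by rewrite mulr_gt0// invr_gt0.
- move=> s z ds zs; rewrite -mulrA EFinM lee_pmul2l//; first exact: hN.
  by rewrite lte_fin invr_gt0.
Qed.
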